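(* Let $n$ be a natural number, $P$ a predicate on families, and $Q$ a predicate on pairs (family, set) that incrementally checks $P$. Then for every list $[l_0,\ldots,l_m]$ of natural numbers, $$\mathcal{L}([l_0,\ldots,l_{m-1},l_m+1],n,P)=\bigcup_{A\in \mathcal{S}(n,m)}\{F\cup\{A\} : F\in\mathcal{L}([l_0,\ldots,l_m],n,P),\ A\notin F,\ Q\,F\,A\}.$$
   Context: All sets and families are finite; sets are sets of natural numbers and $[n]=\{0,1,\ldots,n-1\}$. A family $F$ is over $[n]$ if $\bigcup F\subseteq[n]$. For a list $L=[l_0,\ldots,l_m]$, a family $F$ is $L$-partitioned if every $A\in F$ has $|A|\le m$ and, for each $0\le i\le m$, exactly $l_i$ members of $F$ have exactly $i$ elements (for the empty list this means $F=\emptyset$). $\mathcal{L}(L,n,P)$ denotes the collection of all $L$-partitioned families over $[n]$ satisfying $P$. $\mathcal{S}(n,m)$ denotes the collection of all $A\subseteq[n]$ with $|A|=m$. The predicate $Q$ incrementally checks $P$ if for every family $F$ and set $A$ such that $|A|\ge|A'|$ for all $A'\in F$ and $A\notin F$, we have $P(F\cup\{A\})\iff (P(F)\text{ and } Q\,F\,A)$. *)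

(* Defs.v *)
From mathcomp Require Import all_boot finmap.
From mathcomp Require Import boolp classical_sets.

Set Implicit Arguments.
Unset Strict Implicit.
Unset Printing Implicit Defensive.

Local Open Scope fset_scope.
Local Open Scope classical_set_scope.

Notation set_family := {fset {fset nat}}.

(* [n] = {0, ..., n - 1} *)
Definition initial (n : nat) : {fset nat} := [fset x in iota 0 n]%fset.

Definition over (n : nat) (F : set_family) : Prop :=
  ((\bigcup_(A <- F) A)%fset `<=` initial n)%fset.

(* A list [l_0, ..., l_m] has size m + 1, so "at most m elements" reads
   "fewer than size L elements"; for the empty list this forces F to be
   empty. *)
Definition partitioned (L : seq nat) (F : set_family) : Prop :=
  (forall A : {fset nat}, A \in F -> #|` A| < size L) /\
  (forall i : nat, i < size L ->
     #|` [fset A in F | #|` A| == i]%fset| = nth 0 L i).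

Definition partitioned_families (L : seq nat) (n : nat) (P : set_family -> Prop) :
    set set_family :=
  [set F : set_family | [/\ partitioned L F, over n F & P F]].

Definition subsets_of_card (n m : nat) : set {fset nat} :=
  [set A : {fset nat} | (A `<=` initial n)%fset /\ #|` A| = m].

Definition incrementally_checks (Q : set_family -> {fset nat} -> Prop)
    (P : set_family -> Prop) : Prop :=
  forall (F : set_family) (A : {fset nat}),
    (forall A' : {fset nat}, A' \in F -> #|` A'| <= #|` A|) -> A \notin F ->
    P (F `|` [fset A])%fset <-> P F /\ Q F A.

(* Main.v *)
Require Import Defs.
From mathcomp Require Import all_boot finmap.
From mathcomp Require Import boolp classical_sets.

Set Implicit Arguments.
Unset Strict Implicit.
Unset Printing Implicit Defensive.

Local Open Scope fset_scope.
Local Open Scope classical_set_scope.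

(** Let [A] have [size l] elements, the largest size that the list allows, with [A \notin F].
    Adjoining [A] to [F] raises only the last layer count, by one ([partitioned_rconsU1]), and over
    [initial n] it requires just that [A] be a subset ([overU1]). As [A] is at least as large as
    every member of [F], [Q] decides whether [P] survives. These facts combine into the equivalence
    [addE], which gives both inclusions: a family on the left has a nonempty top layer, and any set
    of that layer can serve as the adjoined [A]. *)

Lemma card_filter_fsetU1 (K : choiceType) (p : pred K) (F : {fset K}) (A : K) :
  A \notin F ->
  #|` [fset B in (F `|` [fset A])%fset | p B]%fset| =
  (p A + #|` [fset B in F | p B]%fset|)%N.
Proof.
move=> AF; case: (boolP (p A)) => pA.
  have -> : [fset B in (F `|` [fset A])%fset | p B]%fset =
            (A |` [fset B in F | p B])%fset.
    apply/fsetP => B; rewrite !inE /=.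
    by case: eqP => [->|_]; rewrite ?pA ?orbT ?orbF.
  by rewrite cardfsU1 !inE /= (negbTE AF).
congr #|` _|; apply/fsetP => B; rewrite !inE /=.
by case: eqP => [->|_]; rewrite ?(negbTE pA) ?andbF ?orbF.
Qed.

Lemma overU1 (n : nat) (F : set_family) (A : {fset nat}) :
  Defs.over n (F `|` [fset A])%fset <-> Defs.over n F /\ (A `<=` initial n)%fset.
Proof.
split=> [/bigfcupsP h|[/bigfcupsP hF hA]].
  split; last by apply: h => //; rewrite !inE eqxx orbT.
  by apply/bigfcupsP => B BF _; apply: h => //; rewrite !inE BF.
by apply/bigfcupsP => B; rewrite !inE => /orP[/hF|/eqP->] //; apply.
Qed.

(** The new set counts only in layer [size l], exactly the index of the last entry, so both sides of
    that layer's equation grow by one; cancelling gives the converse. *)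
Lemma partitioned_rconsU1 (l : seq nat) (lm : nat) (F : set_family)
    (A : {fset nat}) : A \notin F -> #|` A| = size l ->
  partitioned (rcons l lm.+1) (F `|` [fset A])%fset <->
  partitioned (rcons l lm) F.
Proof.
move=> AF cA.
(* The boolean summand matches the term [p A] of [card_filter_fsetU1]. *)
have nthE i : nth 0 (rcons l lm.+1) i =
    ((size l == i) + nth 0 (rcons l lm) i)%N.
  by rewrite !nth_rcons [i == _]eq_sym; case: ltngtP.
split=> -[]; rewrite !size_rcons => hlt hcard; split; rewrite ?size_rcons.
- by move=> B BF; apply: hlt; rewrite !inE BF.
- move=> i /hcard; rewrite nthE (card_filter_fsetU1 _ AF) cA.
  exact: addnI.
- by move=> B; rewrite !inE => /orP[/hlt //|/eqP ->]; rewrite cA.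
- by move=> i /hcard ci; rewrite nthE (card_filter_fsetU1 _ AF) cA ci.
Qed.

Theorem theorem3 (n : nat) (P : set_family -> Prop)
    (Q : set_family -> {fset nat} -> Prop) (hQ : incrementally_checks Q P)
    (l : seq nat) (lm : nat) :
  partitioned_families (rcons l lm.+1) n P =
  \bigcup_(A in subsets_of_card n (size l))
    [set (F `|` [fset A])%fset | F in
      [set F : set_family | [/\ partitioned_families (rcons l lm) n P F,
                            A \notin F & Q F A]]].
Proof.
have addE (F : set_family) (A : {fset nat}) : A \notin F -> #|` A| = size l ->
    partitioned_families (rcons l lm.+1) n P (F `|` [fset A])%fset <->
    [/\ partitioned_families (rcons l lm) n P F, (A `<=` initial n)%fset
      & Q F A].
  move=> AF cA; split.
    case=> /(partitioned_rconsU1 _ AF cA) hF /overU1[oF An].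
    (* The list for [F] has length [(size l).+1], so [A] has maximal size, as [hQ] demands. *)
    have leA (B : {fset nat}) : B \in F -> #|` B| <= #|` A|.
      by case: hF => + _ => /(_ B); rewrite size_rcons cA ltnS.
    by move=> /(hQ _ _ leA AF)[].
  case=> -[hF oF PF] An QFA; split.
  - exact/partitioned_rconsU1.
  - exact/overU1.
  - apply/hQ => // B; case: hF => + _ => /(_ B).
    by rewrite size_rcons cA ltnS.
apply/seteqP; split=> [G GL|G [A [An cA] [F [FL AF QFA] <-]]]; last first.
  by apply/addE.
(* The top layer has [lm.+1 > 0] members. *)
have [A AG cA] : exists2 A, A \in G & #|` A| = size l.
  case: GL => -[_ /(_ (size l))] + _ _.
  rewrite size_rcons nth_rcons ltnn eqxx => /(_ (ltnSn _)) cG.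
  have /fset0Pn[A] : [fset A in G | #|` A| == size l]%fset != fset0.
    by rewrite -cardfs_gt0 cG.
  by rewrite !inE /= => /andP[AG /eqP cA]; exists A.
(* The witness for [F] is [G] with [A] removed. *)
have GE : ((G `\ A) `|` [fset A])%fset = G by rewrite fsetUC fsetD1K.
have AF : A \notin (G `\ A)%fset by rewrite !inE eqxx.
move: GL; rewrite -{1}GE => /(addE _ _ AF cA)[FL An QFA].
by exists A => //; exists (G `\ A)%fset.
Qed.
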